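(* Let $R$ be a compact discrete valuation ring with maximal ideal $\mathfrak{m}$. For each finitely generated $R$-module $M$ there is a unique topology on $M$ turning it into a topological $R$-module. Moreover: (i) if $M\cong R$, this topology is the one obtained by endowing $R$ with its metric space topology; (ii) if $M\cong R/\mathfrak{m}^n$ for some $n\geq 1$, this topology is discrete; (iii) if $M$ and $N$ are non-trivial finitely generated $R$-modules, then this topology on $M\times N$ is equal to the product of these topologies on $M$ and $N$.
   Context: A discrete valuation ring (DVR) $R$ carries the metric topology of its valuation (powers of the maximal ideal form a basis of neighborhoods of $0$); it is called compact if it is compact in this topology. A topological $R$-module is an $R$-module with a Hausdorff topology for which addition $M\times M\to M$, inversion $M\to M$ and scalar multiplication $R\times M\to M$ are continuous. *)

(* Defs.v *)
From HB Require Import structures.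
From mathcomp Require Import all_boot all_order all_algebra.
From mathcomp Require Import all_classical all_reals all_analysis.

Set Implicit Arguments.
Unset Strict Implicit.
Unset Printing Implicit Defensive.

Import GRing.Theory.
Import Quotient.

Local Open Scope classical_set_scope.
Local Open Scope ring_scope.

(* MathComp-Analysis attaches a topology to a type by canonical inference,
   whereas here the topologies on a fixed module are quantified over.  They are
   therefore data, and [topologized t] is the carrier seen as a topological
   space of the library.  The axioms are those of [isOpenTopological]; that the
   empty set is open is the instance [I := void] of [is_open_bigcup]. *)
Record topology_on (T : Type) := Topology {
  is_open : set_system T ;
  is_openT : is_open setT ;
  is_openI : setI_closed is_open ;
  is_open_bigcup : forall (I : Type) (f : I -> set T),
    (forall i, is_open (f i)) -> is_open (\bigcup_i f i)
}.

Definition topologized (T : choiceType) (t : topology_on T) : Type := T.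

HB.instance Definition _ (T : choiceType) (t : topology_on T) :=
  Choice.copy (topologized t) T.
HB.instance Definition _ (T : choiceType) (t : topology_on T) :=
  @isOpenTopological.Build (topologized t)
    (is_open t) (is_openT t) (@is_openI T t) (@is_open_bigcup T t).

Lemma open_topologizedE (T : choiceType) (t : topology_on T) :
  @open (topologized t) = is_open t.
Proof. by []. Qed.

Section Ideals.
Variable R : comNzRingType.

Definition is_ideal (I : set R) : Prop :=
  [/\ I 0, (forall x y, I x -> I y -> I (x + y))
    & (forall r x, I x -> I (r * x))].

Definition principal_ideal (I : set R) : Prop :=
  exists a : R, I = [set r * a | r in [set: R]].

Definition maximal_ideal (m : set R) : Prop :=
  [/\ is_ideal m, ~ m 1
    & forall J : set R, is_ideal J -> m `<=` J -> ~ J 1 -> J = m].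

Definition ideal_gen (A : set R) : set R :=
  [set x | forall I : set R, is_ideal I -> A `<=` I -> I x].

Fixpoint ideal_pow (m : set R) (n : nat) : set R :=
  if n is k.+1 then
    ideal_gen [set z | exists x y, [/\ m x, ideal_pow m k y & z = x * y]]
  else setT.

Lemma ideal_gen_ideal (A : set R) : is_ideal (ideal_gen A).
Proof.
split=> [I [] //|x y Ax Ay I II AI|r x Ax I II AI].
- by case: (II) => _ ID _; apply: ID; [apply: Ax|apply: Ay].
- by case: (II) => _ _ IM; apply: IM; apply: Ax.
Qed.

Lemma ideal_pow_ideal (m : set R) (n : nat) : is_ideal (ideal_pow m n).
Proof. by case: n => [|n]; [split|exact: ideal_gen_ideal]. Qed.

Lemma ideal_powS (m : set R) (n : nat) : ideal_pow m n.+1 `<=` ideal_pow m n.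
Proof.
move=> x /(_ _ (ideal_pow_ideal m n)); apply=> _ [a [b [_ mb ->]]].
by case: (ideal_pow_ideal m n) => _ _; apply.
Qed.

Lemma ideal_pow_le (m : set R) (k n : nat) :
  (k <= n)%N -> ideal_pow m n `<=` ideal_pow m k.
Proof.
move=> /subnK <-; elim: (n - k)%N => [|d IH] //.
by apply: subset_trans IH; exact: ideal_powS.
Qed.

(* U is open when it contains, with each x, a coset x + m^n.  In a discrete
   valuation ring these cosets are exactly the balls about x of the metric
   c ^ v(x - y), 0 < c < 1, of the valuation v. *)
Definition adic_open (m : set R) : set_system R :=
  [set U | forall x, U x -> exists n, forall y, ideal_pow m n (y - x) -> U y].

Lemma adic_openT m : adic_open m setT.
Proof. by move=> x _; exists 0%N. Qed.

Lemma adic_openI m : setI_closed (adic_open m).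
Proof.
move=> U V oU oV x [/oU[k Uk] /oV[n Vn]]; exists (maxn k n) => y yx; split.
- by apply: Uk; apply: ideal_pow_le yx; exact: leq_maxl.
- by apply: Vn; apply: ideal_pow_le yx; exact: leq_maxr.
Qed.

Lemma adic_open_bigcup m (I : Type) (f : I -> set R) :
  (forall i, adic_open m (f i)) -> adic_open m (\bigcup_i f i).
Proof.
move=> of_ x [i _ fx]; have [n fn] := of_ i x fx.
by exists n => y /fn fy; exists i.
Qed.

Definition adic_topology (m : set R) : topology_on R :=
  Topology (@adic_openT m) (@adic_openI m) (@adic_open_bigcup m).

Lemma nbhs_adicE (m : set R) (x : R) (U : set R) :
  nbhs (x : topologized (adic_topology m)) U <->
  exists n, forall y, ideal_pow m n (y - x) -> U y.
Proof.
split=> [|[n nU]].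
  rewrite nbhsE => -[V [oV Vx] VU]; have [n nV] := oV x Vx.
  by exists n => y /nV /VU.
rewrite nbhsE; exists [set z | exists k, forall y, ideal_pow m k (y - z) -> U y].
  split; last by exists n.
  move=> z [k kU]; exists k => y yz; exists k => w wy; apply: kU.
  have [_ ID _] := ideal_pow_ideal m k.
  by rewrite -(subrK y w) -addrA; apply: ID.
move=> z [k kU]; apply: kU; rewrite subrr.
by case: (ideal_pow_ideal m k).
Qed.

End Ideals.

(* R is a discrete valuation ring with maximal ideal m: a local principal ideal
   domain that is not a field. *)
Definition is_dvr (R : idomainType) (m : set R) : Prop :=
  [/\ forall I : set R, is_ideal I -> principal_ideal I,
      maximal_ideal m,
      forall m' : set R, maximal_ideal m' -> m' = m
    & m <> [set 0]].

(* The module R / m^n: the library's quotient of an additive group by a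
   subgroup, with the induced scalar multiplication. *)
Section QuotientModule.
Variables (R : comNzRingType) (m : set R) (n : nat).

Definition ideal_pow_pred : {pred R} := fun x => `[< ideal_pow m n x >].

Lemma ideal_pow_pred_closed : zmod_closed ideal_pow_pred.
Proof.
have [I0 ID IM] := ideal_pow_ideal m n; split; first exact/asboolP.
move=> x y /asboolP Ix /asboolP Iy; apply/asboolP.
by apply: ID => //; rewrite -mulN1r; exact: IM.
Qed.

HB.instance Definition _ :=
  GRing.isZmodClosed.Build R ideal_pow_pred ideal_pow_pred_closed.

Definition quot_pow : Type := {quot ideal_pow_pred}.

HB.instance Definition _ := GRing.Zmodule.on quot_pow.

Definition quot_pow_scale (a : R) (x : quot_pow) : quot_pow :=
  \pi_({quot ideal_pow_pred})%qT (a * repr (x : {quot ideal_pow_pred})).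

Let pi (x : R) : quot_pow := \pi_({quot ideal_pow_pred})%qT x.

Lemma pi_quot_pow_eq (x y : R) : ideal_pow m n (x - y) -> pi x = pi y.
Proof. by move=> ?; apply/eqP; rewrite -idealrBE; apply/asboolP. Qed.

Lemma quot_pow_scaleE (a x : R) : quot_pow_scale a (pi x) = pi (a * x).
Proof.
apply: pi_quot_pow_eq; rewrite -mulrBr.
have [_ _ IM] := ideal_pow_ideal m n; apply: IM; apply/asboolP.
by rewrite -[X in is_true X]/(_ \in ideal_pow_pred) idealrBE reprK.
Qed.

Let pi_surj (x : quot_pow) : exists y : R, x = pi y.
Proof. by exists (repr (x : {quot ideal_pow_pred})); rewrite /pi reprK. Qed.

Let piD (x y : R) : pi (x + y) = pi x + pi y.
Proof. exact: raddfD. Qed.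

Lemma quot_pow_scaleA a b x :
  quot_pow_scale a (quot_pow_scale b x) = quot_pow_scale (a * b) x.
Proof. by have [y ->] := pi_surj x; rewrite !quot_pow_scaleE mulrA. Qed.

Lemma quot_pow_scale1 : left_id 1 quot_pow_scale.
Proof. by move=> x; have [y ->] := pi_surj x; rewrite quot_pow_scaleE mul1r. Qed.

Lemma quot_pow_scaleDr : right_distributive quot_pow_scale +%R.
Proof.
move=> a x y; have [x' ->] := pi_surj x; have [y' ->] := pi_surj y.
by rewrite -piD !quot_pow_scaleE mulrDr piD.
Qed.

Lemma quot_pow_scaleDl x : {morph quot_pow_scale^~ x : a b / a + b}.
Proof.
move=> a b; have [y ->] := pi_surj x.
by rewrite !quot_pow_scaleE mulrDl piD.
Qed.

HB.instance Definition _ := GRing.Zmodule_isLmodule.Build R quot_pow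
  quot_pow_scaleA quot_pow_scale1 quot_pow_scaleDr quot_pow_scaleDl.

End QuotientModule.

Section Modules.
Variable R : comNzRingType.

Definition finitely_generated (M : lmodType R) : Prop :=
  exists (k : nat) (g : 'I_k -> M),
    forall x : M, exists c : 'I_k -> R, x = \sum_(i < k) c i *: g i.

Definition nontrivial (M : lmodType R) : Prop := exists x : M, x != 0.

Definition topological_module (tR : topology_on R) (M : lmodType R)
    (t : topology_on M) : Prop :=
  [/\ hausdorff_space (topologized t),
      continuous (fun p : topologized t * topologized t =>
        ((p.1 : M) + (p.2 : M) : topologized t)),
      continuous (fun x : topologized t => (- (x : M) : topologized t))
    & continuous (fun p : topologized tR * topologized t =>
        ((p.1 : R) *: (p.2 : M) : topologized t))].

End Modules.

(* Main.v *)
Require Import Defs.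
From HB Require Import structures.
From mathcomp Require Import all_boot all_order all_algebra.
From mathcomp Require Import all_classical all_reals all_analysis.

(** Let p generate the maximal ideal.  Every statement below follows from one
    fact: on a finitely generated module M the only module topology is the
    p-adic one, in which the cosets x + p^n M form a basis of neighbourhoods
    of x ([topological_module_adic]).  For M isomorphic to R this is the metric
    topology, for R/m^n it is discrete because p^n M = 0, and on a product it
    is the product topology because p^n (M x N) = p^n M x p^n N.

    In any module topology a finitely generated submodule is a continuous
    image of a power of the compact ring R, hence is compact ([span_compact]).
    An open set of a module topology t is p-adically open, since
    c_1 g_1 + ... + c_k g_k tends to 0 when all c_i do
    ([open_adic_module_open]).  So the identity from M with the p-adic topology
    to M with t is a continuous bijection from a compact space to a Hausdorff
    one, which is a homeomorphism.

    Existence is continuity of the operations, which is a computation, and the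
    Hausdorff axiom, which is Krull's theorem that the intersection of the
    p^n M is 0 ([fg_adically_separated]).  Compactness gives the latter too.
    Write M as a quotient of R^k by K.  As R is principal, K is finitely
    generated ([submodule_span]), so K is compact, hence closed, in the p-adic
    topology of R^k, which is Hausdorff coordinate by coordinate
    ([principal_domain_separated]).  A point of R^k over an element of every
    p^n M lies in the closure of K, that is, in K.  *)

Set Implicit Arguments.
Unset Strict Implicit.
Unset Printing Implicit Defensive.

Import GRing.Theory.

Local Open Scope classical_set_scope.
Local Open Scope ring_scope.

(** * Submodules and finite generation *)

Section Submodules.
Variable R : comNzRingType.

Definition submodule (M : lmodType R) (K : set M) : Prop :=
  K 0 /\ forall a x y, K x -> K y -> K (a *: x + y).

(** Defined by recursion on the generators, as all later arguments about spans
    add one generator at a time.  *)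
Fixpoint span (M : lmodType R) (g : seq M) : set M :=
  if g is a :: s then
    [set rx.1 *: a + rx.2 | rx in [set: R] `*` span s]
  else [set 0].

Lemma span_submodule (M : lmodType R) (g : seq M) : submodule (span g).
Proof.
elim: g => [|a s [s0 sD]] /=.
  by split=> // a x y -> ->; rewrite scaler0 addr0.
split; first by exists (0, 0); rewrite //= scale0r addr0.
move=> c _ _ [[r x] [_ /= sx] <-] [[q y] [_ /= sy] <-].
exists (c * r + q, c *: x + y); first by split=> //; exact: sD.
by rewrite /= scalerDr scalerDl scalerA addrACA.
Qed.

Lemma submoduleZ (M : lmodType R) (K : set M) (a : R) (x : M) :
  submodule K -> K x -> K (a *: x).
Proof. by move=> [K0 KD] Kx; rewrite -[_ *: _]addr0; exact: KD. Qed.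

Lemma submoduleB (M : lmodType R) (K : set M) (x y : M) :
  submodule K -> K x -> K y -> K (x - y).
Proof. by move=> [K0 KD] Kx Ky; rewrite addrC -scaleN1r; exact: KD. Qed.

Lemma span_sum (M : lmodType R) (I : Type) (s : seq I) (c : I -> R)
    (g : I -> M) :
  span (map g s) (\sum_(i <- s) c i *: g i).
Proof.
elim: s => [|i s IH] /=; first by rewrite big_nil.
by rewrite big_cons; exists (c i, \sum_(j <- s) c j *: g j).
Qed.

Lemma finitely_generated_span (M : lmodType R) :
  finitely_generated M -> exists g : seq M, span g = setT.
Proof.
move=> [k [g gP]]; exists (map g (index_enum 'I_k)).
by rewrite -subTset => x _; have [c ->] := gP x; exact: span_sum.
Qed.

Lemma finitely_generated_prod (M N : lmodType R) :
  finitely_generated M -> finitely_generated N ->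
  finitely_generated (M * N)%type.
Proof.
move=> [k [g gP]] [l [h hP]]; exists (k + l)%N.
exists (fun i : 'I_(k + l) =>
  match fintype.split i with inl i => (g i, 0) | inr j => (0, h j) end).
move=> [x y]; have [[c xE] [d yE]] := (gP x, hP y).
exists (fun i : 'I_(k + l) =>
  match fintype.split i with inl i => c i | inr j => d j end).
rewrite big_split_ord /=.
under eq_bigr => i _ do rewrite (unsplitK (inl i)).
under [X in _ + X]eq_bigr => i _ do rewrite (unsplitK (inr i)).
have -> : \sum_(i < k) c i *: (g i, 0 : N) = (x, 0).
  rewrite xE; elim/big_rec2: _ => // i u v _ ->.
  by congr (_, _); rewrite /= scaler0 addr0.
have -> : \sum_(i < l) d i *: (0 : M, h i) = (0, y).
  rewrite yE; elim/big_rec2: _ => // i u v _ ->.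
  by congr (_, _); rewrite /= scaler0 addr0.
by congr (_, _); rewrite /= ?addr0 ?add0r.
Qed.

(** The coefficients of the first generator a that occur in elements of K form
    an ideal; its generator b lifts to an element of K, and subtracting
    multiples of this element reduces K to its part in the span of the other
    generators, to which induction applies.  *)
Lemma submodule_span (M : lmodType R) (g : seq M) (K : set M) :
  (forall I : set R, is_ideal I -> principal_ideal I) ->
  submodule K -> K `<=` span g -> exists h : seq M, K = span h.
Proof.
move=> pid; elim: g K => [|a s IH] K subK Kg.
  exists [::]; apply/seteqP; split=> // x ->.
  by case: subK.
have [K0 KD] := subK; have subs := span_submodule s; have [s0 sD] := subs.
have [h Kh] : exists h, K `&` span s = span h.
  apply: IH => [|x []//]; split=> // c x y [Kx sx] [Ky sy].
  by split; [exact: KD|exact: sD].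
pose I := [set r | exists2 y, span s y & K (r *: a + y)].
have /pid[b Ib] : is_ideal I.
  split; first by exists 0; rewrite // scale0r addr0.
  - move=> r q [y sy Ky] [z sz Kz]; exists (1 *: y + z); first exact: sD.
    by have := KD 1 _ _ Ky Kz; rewrite scale1r scale1r scalerDl addrACA.
  - move=> r q [y sy Ky]; exists (r *: y); first exact: submoduleZ.
    by rewrite -scalerA -scalerDr; exact: submoduleZ.
have [y0 sy0 Ky0] : I b by rewrite Ib; exists 1; rewrite ?mul1r.
exists ((b *: a + y0) :: h); rewrite /= -Kh; apply/seteqP; split.
  move=> x Kx; have [[r y] [_ /= sy] xE] := Kg x Kx.
  have : I r by exists y; rewrite // xE.
  rewrite Ib => -[q _ qb].
  have xy : x - q *: (b *: a + y0) = y - q *: y0.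
    by rewrite -xE scalerDr scalerA qb opprD addrACA subrr add0r.
  exists (q, x - q *: (b *: a + y0)); last by rewrite /= addrC subrK.
  split=> //; split; first by apply: submoduleB => //; exact: submoduleZ.
  by rewrite /= xy; apply: submoduleB => //; exact: submoduleZ.
by move=> _ [[q y] [_ [/= Ky _]] <-]; exact: KD.
Qed.

End Submodules.

(** * Powers of the maximal ideal *)

Section Powers.
Variable R : comNzRingType.

Lemma ideal_pow_principal (m : set R) (p : R) :
  m = [set r * p | r in [set: R]] ->
  forall n, ideal_pow m n = [set r * p ^+ n | r in [set: R]].
Proof.
move=> mp; elim=> [|n IH].
  apply/seteqP; split=> // r _; exists r => //.
  by rewrite expr0 mulr1.
apply/seteqP; split=> [x|_ [r _ <-]].
- apply.
    split; first by exists 0; rewrite ?mul0r.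
      move=> _ _ [r _ <-] [q _ <-]; exists (r + q) => //.
      by rewrite mulrDl.
    by move=> q _ [r _ <-]; exists (q * r); rewrite ?mulrA.
  move=> _ [y [z [my mz ->]]].
  move: (my) (mz : ideal_pow m n z); rewrite IH mp => -[r _ <-] [q _ <-].
  by exists (r * q); rewrite // exprS mulrACA.
- move=> I idI; apply; exists p, (r * p ^+ n); split.
  + by rewrite mp; exists 1; rewrite ?mul1r.
  + by rewrite IH; exists r.
  + by rewrite exprS mulrCA.
Qed.

Lemma quot_pow_torsion (m : set R) (n : nat) (a : R) (x : quot_pow m n) :
  ideal_pow m n a -> a *: x = 0.
Proof.
move=> ma; transitivity (0 *: x); last exact: scale0r.
apply: pi_quot_pow_eq; rewrite mul0r subr0 mulrC.
by have [_ _] := ideal_pow_ideal m n; apply.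
Qed.

End Powers.

(** The intersection of the ideals (p^n) is an ideal (a).  Cancelling one p
    shows that a = p b with b in the intersection again, so a = p r a for
    some r.  As p is not invertible, a = 0.  *)
Lemma principal_domain_separated (R : idomainType) (p : R) :
  (forall I : set R, is_ideal I -> principal_ideal I) ->
  p != 0 -> (forall r, r * p != 1) ->
  forall x : R, (forall n, exists y, x = p ^+ n * y) -> x = 0.
Proof.
move=> pid p0 pN1.
pose I := [set x : R | forall n, exists y, x = p ^+ n * y].
have /pid[a Ia] : is_ideal I.
  split=> [n|x y Ix Iy n|r x Ix n]; first by exists 0; rewrite mulr0.
  - have [[u ->] [v ->]] := (Ix n, Iy n).
    by exists (u + v); rewrite mulrDr.
  - by have [u ->] := Ix n; exists (r * u); rewrite mulrCA.
have aI : I a by rewrite Ia; exists 1; rewrite ?mul1r.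
have [b ab] := aI 1; rewrite expr1 in ab.
have : I b.
  move=> n; have [c ac] := aI n.+1; exists c; apply: (mulfI p0).
  by rewrite -ab ac exprS mulrA.
rewrite Ia => -[r _ rab].
have a0 : a = 0.
  apply/eqP; have /eqP : (1 - r * p) * a = 0.
    by rewrite mulrBl mul1r -mulrA mulrCA rab -ab subrr.
  by rewrite mulf_eq0 subr_eq0 eq_sym (negPf (pN1 r)).
by move=> x Ix; have : I x by []; rewrite Ia a0 => -[s _ <-]; rewrite mulr0.
Qed.

(** * The adic topology of a module *)

Lemma topology_on_eq (T : Type) (t t' : topology_on T) :
  is_open t = is_open t' -> t = t'.
Proof.
case: t t' => [T1 T1T T1I T1U] [T2 T2T T2I T2U] /= T12; subst T2.
by congr Topology; exact: Prop_irrelevance.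
Qed.

Section AdicModule.
Variables (R : comNzRingType) (p : R).

Section Topology.
Variable M : lmodType R.

Definition adic_module_open : set_system M :=
  [set U | forall x, U x -> exists n, forall y, U (x + p ^+ n *: y)].

Lemma adic_module_openT : adic_module_open setT.
Proof. by move=> x _; exists 0. Qed.

Lemma adic_module_openI : setI_closed adic_module_open.
Proof.
move=> U V oU oV x [/oU[k Uk] /oV[n Vn]]; exists (k + n)%N => y.
split; first by rewrite exprD -scalerA; exact: Uk.
by rewrite addnC exprD -scalerA; exact: Vn.
Qed.

Lemma adic_module_open_bigcup (I : Type) (f : I -> set M) :
  (forall i, adic_module_open (f i)) -> adic_module_open (\bigcup_i f i).
Proof.
move=> of_ x [i _ fx]; have [n fn] := of_ i x fx.
by exists n => y; exists i.
Qed.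

Definition adic_module_topology : topology_on M :=
  Topology adic_module_openT adic_module_openI adic_module_open_bigcup.

Lemma nbhs_adic_moduleE (x : M) (U : set M) :
  nbhs (x : topologized adic_module_topology) U <->
  exists n, forall y, U (x + p ^+ n *: y).
Proof.
split=> [|[n nU]].
  rewrite nbhsE => -[V [oV Vx] VU]; have [n nV] := oV x Vx.
  by exists n => y; exact: VU.
rewrite nbhsE; exists [set x + p ^+ n *: y | y in [set: M]].
  split; last by exists 0; rewrite // scaler0 addr0.
  move=> _ [y _ <-]; exists n => z; exists (y + z) => //.
  by rewrite scalerDr addrA.
by move=> _ [y _ <-].
Qed.

(** The Hausdorff axiom of the p-adic topology, in algebraic terms.  *)
Definition adically_separated : Prop :=
  forall x : M, (forall n, exists y, x = p ^+ n *: y) -> x = 0.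

Lemma adic_hausdorff :
  adically_separated -> hausdorff_space (topologized adic_module_topology).
Proof.
move=> sep x y clxy; apply/eqP; rewrite -subr_eq0; apply/eqP.
apply: sep => n.
have ball z : nbhs (z : topologized adic_module_topology)
    [set z + p ^+ n *: w | w in [set: M]].
  by apply/nbhs_adic_moduleE; exists n => w; exists w.
have [_ [[u _ <-] [v _]]] := clxy _ _ (ball x) (ball y).
move=> /(canRL (addKr _)) vE; exists (v - u).
by rewrite scalerBr vE addrA addrK addrC.
Qed.

End Topology.

Variable m : set R.
Hypothesis mp : m = [set r * p | r in [set: R]].

Lemma adic_topological_module (M : lmodType R) :
  adically_separated M ->
  topological_module (adic_topology m) (adic_module_topology M).
Proof.
move=> sep; split.
- exact: adic_hausdorff.
- move=> [x y] U /nbhs_adic_moduleE /= [n Un].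
  exists ([set x + p ^+ n *: z | z in [set: M]],
          [set y + p ^+ n *: z | z in [set: M]]) => /=.
    by split; apply/nbhs_adic_moduleE; exists n => z; exists z.
  move=> _ [/= [u _ <-] [v _ <-]] /=.
  by rewrite addrACA -scalerDr.
- move=> x U /nbhs_adic_moduleE /= [n Un].
  apply/nbhs_adic_moduleE; exists n => y /=.
  by rewrite opprD -scalerN.
- move=> [a x] U /nbhs_adic_moduleE /= [n Un].
  exists ([set b | ideal_pow m n (b - a)],
          [set x + p ^+ n *: z | z in [set: M]]) => /=.
    split; first by apply/nbhs_adicE; exists n.
    by apply/nbhs_adic_moduleE; exists n => z; exists z.
  move=> [b _] [/= + [u _ <-]] /=.
  rewrite (ideal_pow_principal mp) => -[r _ rE].
  have -> : b = a + p ^+ n * r by rewrite (mulrC _ r) rE addrC subrK.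
  have -> : (a + p ^+ n * r) *: (x + p ^+ n *: u) =
      a *: x + p ^+ n *: (a *: u + r *: (x + p ^+ n *: u)).
    rewrite scalerDl -(scalerA _ r) (scalerDr a) (scalerA a) (mulrC a).
    by rewrite -(scalerA _ a) -addrA -scalerDr.
  exact: Un.
Qed.

End AdicModule.

(** * Comparison of module topologies *)

Section Comparison.
Variables (R : comNzRingType) (m : set R) (p : R).
Hypothesis mp : m = [set r * p | r in [set: R]].
Variables (M : lmodType R) (t : topology_on M).
Hypothesis tmod : topological_module (adic_topology m) t.

(** The span of a :: s is the image of R x span s under the continuous map
    (r, x) |-> r a + x.  *)
Lemma span_compact (g : seq M) :
  compact [set: topologized (adic_topology m)] ->
  compact (span g : set (topologized t)).
Proof.
move=> cR; have [_ addc _ scalec] := tmod.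
elim: g => [|a s IH]; first exact: compact_set1.
apply: (@continuous_compact
  (topologized (adic_topology m) * topologized t)%type (topologized t)
  (fun rx => ((rx.1 : R) *: a + (rx.2 : M) : topologized t)));
  last exact: compact_setX.
apply: continuous_subspaceT => -[r x] U /= Uax.
have [[A B] /= [Aa Bx] AB] := addc (r *: a, x) U Uax.
have [[C D] /= [Cr Da] CD] := scalec (r, a) A Aa.
exists (C, B) => //= -[q y] [/= Cq By]; apply: (AB (_, _)); split=> //=.
by apply: (CD (_, _)); split=> //=; exact: nbhs_singleton Da.
Qed.

(** Continuity of scalar multiplication at (0, a), for each of the finitely many
    generators a, makes p^n span g small all at once; at a single point y it
    would only give an n that depends on y.  *)
Lemma pow_span_nbhs0 (g : seq M) (V : set M) :
  nbhs (0 : topologized t) V ->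
  exists n, forall y, span g y -> V (p ^+ n *: y).
Proof.
have [_ addc _ scalec] := tmod.
elim: g V => [|a s IH] V V0.
  by exists 0 => _ ->; rewrite scaler0; exact: nbhs_singleton V0.
have /= := addc (0, 0) V; rewrite addr0 => /(_ V0)[[V1 V2] /= [V10 V20] VV].
have [n2 Vn2] := IH _ V20.
have /= := scalec (0, a) V1; rewrite scale0r => /(_ V10).
move=> [[A B] /= [/nbhs_adicE[n1 An1] Ba] AB].
(* A sum of exponents, so that the surplus power of p is absorbed by the
   coefficient r in one summand and by y in the other. *)
exists (n1 + n2)%N => _ [[r y] [_ /= sy] <-].
have Vra : V1 (p ^+ (n1 + n2) *: (r *: a)).
  rewrite scalerA; apply: (AB (_, a)); split; last exact: nbhs_singleton Ba.
  apply: An1; rewrite subr0 (ideal_pow_principal mp).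
  by exists (p ^+ n2 * r); rewrite // exprD mulrC mulrA.
have Vy : V2 (p ^+ (n1 + n2) *: y).
  rewrite addnC exprD -scalerA; apply: Vn2.
  by apply: submoduleZ => //; exact: span_submodule.
by rewrite scalerDr; exact: (VV (_, _) (conj Vra Vy)).
Qed.

Lemma open_adic_module_open (U : set M) :
  finitely_generated M -> is_open t U -> adic_module_open p U.
Proof.
move=> /finitely_generated_span[g gT] oU x Ux.
have [_ addc _ _] := tmod.
have xU : nbhs ((x : M) + 0 : topologized t) U.
  by rewrite addr0; apply: (@open_nbhs_nbhs (topologized t)).
have [[A B] /= [Ax B0] AB] := addc (x, 0) U xU.
have [n Bn] := pow_span_nbhs0 g B0.
exists n => y; apply: (AB (_, _)); split=> /=; first exact: nbhs_singleton Ax.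
by apply: Bn; rewrite gT.
Qed.

End Comparison.

(** The hypothesis on x says that x lies in the p-adic closure of the span,
    which is compact in a Hausdorff space and so closed.  *)
Lemma adic_span_closed (R : comNzRingType) (m : set R) (p : R)
    (M : lmodType R) (g : seq M) (x : M) :
  m = [set r * p | r in [set: R]] ->
  compact [set: topologized (adic_topology m)] ->
  adically_separated p M ->
  (forall n, exists y, span g (x + p ^+ n *: y)) -> span g x.
Proof.
move=> mp cR sep xg.
have tM := adic_topological_module mp sep.
have [haus _ _ _] := tM.
apply: (@compact_closed (topologized (adic_module_topology p M)) _ haus
  (@span_compact R m M _ tM g cR)) => U /nbhs_adic_moduleE[n Un].
by have [y gy] := xg n; exists (x + p ^+ n *: y).
Qed.

(** * Compact discrete valuation rings *)

Section CompactDVR.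
Variables (R : idomainType) (m : set R).
Hypothesis R_dvr : is_dvr m.
Hypothesis R_compact : compact [set: topologized (adic_topology m)].

Lemma dvr_uniformizer : exists p : R,
  [/\ m = [set r * p | r in [set: R]], p != 0 & forall r, r * p != 1].
Proof.
have [pid [idm m1 _] _ mN0] := R_dvr; have [p mp] := pid _ idm.
exists p; split=> // [|r].
  apply/eqP => p0; apply: mN0; rewrite mp p0; apply/seteqP; split.
    by move=> _ [r _ <-]; rewrite mulr0.
  by move=> _ ->; exists 0; rewrite ?mul0r.
by apply/eqP => rp1; apply: m1; rewrite mp; exists r.
Qed.

Variable p : R.
Hypotheses (mp : m = [set r * p | r in [set: R]]) (p0 : p != 0).
Hypothesis (pN1 : forall r, r * p != 1).

Let pid : forall I : set R, is_ideal I -> principal_ideal I.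
Proof. by case: R_dvr. Qed.

Lemma rV_adically_separated (k : nat) : adically_separated p 'rV[R]_k.
Proof.
move=> c cP; apply/rowP => i; rewrite mxE.
apply: (principal_domain_separated pid p0 pN1) => n; have [d ->] := cP n.
by exists (d 0 i); rewrite mxE.
Qed.

Lemma rV_span (k : nat) :
  span (map (delta_mx 0) (index_enum 'I_k)) = [set: 'rV[R]_k].
Proof.
by rewrite -subTset => c _; rewrite (row_sum_delta c); exact: span_sum.
Qed.

(** Krull's intersection theorem: the kernel of a presentation of M by R^k is
    finitely generated, so it is closed for the p-adic topology of R^k.  *)
Lemma fg_adically_separated (M : lmodType R) :
  finitely_generated M -> adically_separated p M.
Proof.
move=> [k [g gP]] x xP.
pose f (c : 'rV[R]_k) := \sum_(i < k) c 0 i *: g i.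
have fZD a c d : f (a *: c + d) = a *: f c + f d.
  rewrite /f scaler_sumr -big_split; apply: eq_bigr => i _.
  by rewrite !mxE scalerDl scalerA.
have fsurj y : exists c, y = f c.
  have [c ->] := gP y; exists (\row_i c i).
  by apply: eq_bigr => i _; rewrite mxE.
have f0 : f 0 = 0 by apply: big1 => i _; rewrite mxE scale0r.
have [h Kh] : exists h, [set c | f c = 0] = span h.
  apply: (submodule_span (g := map (delta_mx 0) (index_enum 'I_k)) pid).
    by split=> //= a c d fc fd; rewrite fZD fc fd scaler0 addr0.
  by rewrite rV_span.
have [c xc] := fsurj x.
have : span h c.
  apply: (adic_span_closed mp R_compact (@rV_adically_separated k)) => n.
  (* If x = p^n f d, then c - p^n d is in the kernel of f. *)
  have [y xy] := xP n; have [d yd] := fsurj y; exists (- d).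
  rewrite -Kh /= scalerN -scaleNr addrC fZD scaleNr -yd -xy xc.
  by rewrite addNr.
by rewrite -Kh /= -xc.
Qed.

(** Complements of p-adically open sets are p-adically compact, so their images
    under the continuous identity map are compact, hence closed, for t.  *)
Lemma topological_module_adic (M : lmodType R) (t : topology_on M) :
  finitely_generated M -> topological_module (adic_topology m) t ->
  is_open t = adic_module_open p (M := M).
Proof.
move=> fgM tmod.
have amod := adic_topological_module mp (fg_adically_separated fgM).
have ta U : is_open t U -> adic_module_open p U.
  exact: (open_adic_module_open mp tmod).
apply/seteqP; split=> // U aU.
have [g gT] := finitely_generated_span fgM.
have cM := span_compact amod (g := g) R_compact; rewrite gT in cM.
have clU : closed (~` U : set (topologized (adic_module_topology p M))).
  exact: open_closedC.
have cU := subclosed_compact clU cM (@subsetT _ _).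
have idc : {within (~` U : set (topologized (adic_module_topology p M))),
    continuous (fun x => (x : topologized t))}.
  by apply: continuous_subspaceT; apply/continuousP => A; exact: ta.
have := continuous_compact idc cU.
have [haus _ _ _] := tmod.
rewrite image_id => /(compact_closed haus)/closed_openC.
by rewrite setCK.
Qed.

End CompactDVR.

(** * Module topologies over compact discrete valuation rings *)

Theorem theorem2p4 (R : idomainType) (m : set R)
    (R_dvr : is_dvr m)
    (R_compact : compact [set: topologized (adic_topology m)]) :
  [/\ (forall M : lmodType R, finitely_generated M ->
        exists! t : topology_on M, topological_module (adic_topology m) t),
      (forall (M : lmodType R) (t : topology_on M),
        finitely_generated M -> topological_module (adic_topology m) t ->
        forall f : {linear R^o -> M}, bijective f ->
        forall U : set M,
          is_open t U <-> is_open (adic_topology m) (f @^-1` U)),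
      (forall (M : lmodType R) (t : topology_on M),
        finitely_generated M -> topological_module (adic_topology m) t ->
        forall n : nat, (1 <= n)%N ->
        forall f : {linear quot_pow m n -> M}, bijective f ->
        forall U : set M, is_open t U)
    & (forall (M N : lmodType R) (tM : topology_on M) (tN : topology_on N)
          (t : topology_on (M * N)%type),
        finitely_generated M -> finitely_generated N ->
        nontrivial M -> nontrivial N ->
        topological_module (adic_topology m) tM ->
        topological_module (adic_topology m) tN ->
        topological_module (adic_topology m) t ->
        forall U : set (M * N)%type,
          is_open t U <->
          open (U : set (topologized tM * topologized tN)%type))].
Proof.
have [p [mp p0 pN1]] := dvr_uniformizer R_dvr.
have sep := fg_adically_separated R_dvr R_compact mp p0 pN1.
have adic := topological_module_adic R_dvr R_compact mp p0 pN1.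
have powE := ideal_pow_principal mp.
split.
- move=> M fgM; exists (adic_module_topology p M); split.
    exact: (adic_topological_module mp (sep M fgM)).
  by move=> t tmod; apply: topology_on_eq; rewrite (adic M t fgM tmod).
- move=> M t fgM tmod f [f' fK f'K] U; rewrite (adic M t fgM tmod).
  have shift n (a r : R) : f (a + r * p ^+ n) = f a + p ^+ n *: f r.
    by rewrite mulrC -[_ * r]/(p ^+ n *: (r : R^o)) linearD linearZ.
  split=> [oU a Ua|oU x].
    have [n Un] := oU _ Ua; exists n => b; rewrite powE => -[r _ rE].
    by rewrite /= -(subrK a b) -rE addrC shift.
  rewrite -{1}(f'K x) => /oU[n Un]; exists n => y.
  rewrite -(f'K x) -(f'K y) -shift; apply: Un.
  by rewrite powE; exists (f' y); rewrite // addrC addKr.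
- move=> M t fgM tmod n _ f [f' fK f'K] U; rewrite (adic M t fgM tmod) => x Ux.
  exists n => y; suff -> : p ^+ n *: y = 0 by rewrite addr0.
  rewrite -(f'K y) -linearZ; suff -> : p ^+ n *: f' y = 0 by rewrite linear0.
  by apply: quot_pow_torsion; rewrite powE; exists 1; rewrite ?mul1r.
- move=> M N tM tN t fgM fgN _ _ tmodM tmodN tmod U.
  have nbhsE (L : lmodType R) (s : topology_on L) (x : L) (V : set L) :
      finitely_generated L -> topological_module (adic_topology m) s ->
      nbhs (x : topologized s) V <-> exists n, forall y, V (x + p ^+ n *: y).
    move=> fgL smod; rewrite -nbhs_adic_moduleE.
    rewrite (topology_on_eq (t := s) (t' := adic_module_topology p L)) //.
    exact: adic.
  have fgMN : finitely_generated (M * N)%type by exact: finitely_generated_prod.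
  rewrite (adic _ t fgMN tmod) openE; split=> oU [x y] Uxy.
    have [n Un] := oU _ Uxy.
    exists ([set x + p ^+ n *: z | z in [set: M]],
            [set y + p ^+ n *: z | z in [set: N]]) => /=.
      by split; apply/nbhsE => //; exists n => z; exists z.
    by move=> [_ _] [/= [u _ <-] [v _ <-]]; exact: (Un (u, v)).
  have [[A B] /= [Ax By] AB] := oU _ Uxy.
  move: Ax By => /nbhsE-/(_ fgM tmodM)[k Ak] /nbhsE-/(_ fgN tmodN)[l Bl].
  exists (k + l)%N => -[u v]; apply: (AB (_, _)); split=> /=.
    by rewrite exprD -scalerA; exact: Ak.
  by rewrite addnC exprD -scalerA; exact: Bl.
Qed.
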